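(* Suppose $\Gamma, x:B \vdash_{\sf s} M : A$ and $\Gamma \vdash_{\sf s} N : B$ are derivable judgements of the safe lambda calculus. Then no variable capture occurs when performing the capture-permitting substitution $M\{N/x\}$ of $N$ for $x$ in $M$; that is, no free variable occurrence of $N$ becomes bound in $M\{N/x\}$.
   Context: Simple types are generated by $A ::= o \mid A \to A$ ($\to$ associates to the right); $(A_1,\ldots,A_n,B)$ abbreviates $A_1\to\cdots\to A_n\to B$. Orders: $\mathrm{ord}(o)=0$, $\mathrm{ord}(A\to B)=\max(\mathrm{ord}(A)+1,\mathrm{ord}(B))$. Terms are Church-style, built from an infinite set of typed variables (each variable has a fixed type) and a fixed set $\Xi$ of typed constants (of arbitrary simple types). The order of a term or symbol is the order of its type. Safe lambda calculus. Judgements $\Gamma\vdash_{\sf s} M:A$ (safe) and $\Gamma\vdash_{\sf asa} M:A$ (almost safe application) are defined by mutual induction. For a context $\Gamma$, ''$c\le \mathrm{ord}\,\Gamma$'' means $c\le \mathrm{ord}(y)$ for every variable $y\in\Gamma$. (var) $x:A\vdash_{\sf s}x:A$. (const) $\vdash_{\sf s} f:A$ for each constant $f:A$ in $\Xi$. (wk) from $\Gamma\vdash_{\sf s}M:A$ infer $\Delta\vdash_{\sf s}M:A$ if $\Gamma\subset\Delta$. ($\delta$) from $\Gamma\vdash_{\sf s}M:A$ infer $\Gamma\vdash_{\sf asa}M:A$. (app$_{as}$) from $\Gamma\vdash_{\sf asa}M:A\to B$ and $\Gamma\vdash_{\sf s}N:A$ infer $\Gamma\vdash_{\sf asa}MN:B$.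 (app) from $\Gamma\vdash_{\sf asa}M:A\to B$ and $\Gamma\vdash_{\sf s}N:A$ infer $\Gamma\vdash_{\sf s}MN:B$, provided $\mathrm{ord}(B)\le\mathrm{ord}\,\Gamma$. (abs) from $\Gamma,x_1:A_1,\ldots,x_n:A_n\vdash_{\sf asa}M:B$ infer $\Gamma\vdash_{\sf s}\lambda x_1^{A_1}\ldots x_n^{A_n}.M:(A_1,\ldots,A_n,B)$, provided $\mathrm{ord}(A_1,\ldots,A_n,B)\le\mathrm{ord}\,\Gamma$. Capture-permitting substitution $M\{N/x\}$: textually replace all free occurrences of $x$ in $M$ by $N$ without renaming bound variables; in particular $(\lambda y_1\ldots y_n.M)\{N/x\}=\lambda y_1\ldots y_n.(M\{N/x\})$ when $x\notin\{y_1,\ldots,y_n\}$, and $(\lambda y_1\ldots y_n.M)\{N/x\}=\lambda y_1\ldots y_n.M$ when $x\in\{y_1,\ldots,y_n\}$. *)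

(* Defs.v *)
From HB Require Import structures.
From mathcomp Require Import all_boot finmap.

Set Implicit Arguments.
Unset Strict Implicit.
Unset Printing Implicit Defensive.

Local Open Scope fset_scope.

Inductive sty : Type :=
| Ground : sty
| Arr : sty -> sty -> sty.

Fixpoint ord (A : sty) : nat :=
  match A with
  | Ground => 0
  | Arr A1 A2 => maxn (ord A1).+1 (ord A2)
  end.

(* The type (A_1, ..., A_n, B). *)
Definition arrs (As : seq sty) (B : sty) : sty := foldr Arr B As.

(* Each variable and each constant carries its type, so that a typing
   declaration x : A is just the variable x, with A = vtype x. *)
Record signature := Signature {
  var : choiceType;
  vtype : var -> sty;
  var_infinite : forall s : seq var, exists v : var, v \notin s;
  const : Type;
  ctype : const -> sty
}.
Arguments vtype {_} _.
Arguments ctype {_} _.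

(* Raw named terms, not identified up to renaming of bound variables; the
   annotation of a binder is the type of the bound variable. *)
Inductive term (S : signature) : Type :=
| Var of var S
| Cst of const S
| App of term S & term S
| Lam of var S & term S.
Arguments Var {S} _.
Arguments Cst {S} _.

(* The block abstraction \lambda x_1 ... x_n. M. *)
Definition lams (S : signature) (xs : seq (var S)) (M : term S) : term S :=
  foldr (@Lam S) M xs.

Definition ctx (S : signature) := {fset var S}.

Definition le_ord_ctx (S : signature) (c : nat) (G : ctx S) : Prop :=
  forall y : var S, y \in G -> c <= ord (vtype y).

(* The comma of contexts is union.  In safe_abs the side condition makes the
   block disjoint from G, since ord (vtype x_i) < ord (A_1, ..., A_n, B). *)
Inductive safe (S : signature) : ctx S -> term S -> sty -> Prop :=
| safe_var (x : var S) : safe [fset x] (Var x) (vtype x)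
| safe_const (f : const S) : safe fset0 (Cst f) (ctype f)
| safe_wk (G D : ctx S) (M : term S) (A : sty) :
    safe G M A -> G `<=` D -> safe D M A
| safe_app (G : ctx S) (M N : term S) (A B : sty) :
    asa G M (Arr A B) -> safe G N A -> le_ord_ctx (ord B) G ->
    safe G (App M N) B
| safe_abs (G : ctx S) (xs : seq (var S)) (M : term S) (B : sty) :
    0 < size xs -> uniq xs ->
    asa (G `|` [fset x in xs]) M B ->
    le_ord_ctx (ord (arrs (map vtype xs) B)) G ->
    safe G (lams xs M) (arrs (map vtype xs) B)
with asa (S : signature) : ctx S -> term S -> sty -> Prop :=
| asa_delta (G : ctx S) (M : term S) (A : sty) : safe G M A -> asa G M A
| asa_app (G : ctx S) (M N : term S) (A B : sty) :
    asa G M (Arr A B) -> safe G N A -> asa G (App M N) B.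

(* Capture-permitting substitution M{N/x}. *)
Fixpoint subst (S : signature) (M : term S) (x : var S) (N : term S) : term S :=
  match M with
  | Var y => if y == x then N else Var y
  | Cst f => Cst f
  | App P Q => App (subst P x N) (subst Q x N)
  | Lam y P => if y == x then Lam y P else Lam y (subst P x N)
  end.

Lemma subst_lams (S : signature) (ys : seq (var S)) (M : term S) (x : var S)
    (N : term S) :
  subst (lams ys M) x N =
  if x \in ys then lams ys M else lams ys (subst M x N).
Proof.
elim: ys => //= y ys IH; rewrite in_cons (eq_sym x y); case: eqP => //= _.
by rewrite IH; case: ifP.
Qed.

(* An occurrence is identified by its path from the root of the term. *)
Inductive step : Type := Fun | Arg | Body.

Fixpoint subterm_at (S : signature) (M : term S) (p : seq step)
    : option (term S) :=
  match p, M with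
  | [::], _ => Some M
  | Fun :: p', App P _ => subterm_at P p'
  | Arg :: p', App _ Q => subterm_at Q p'
  | Body :: p', Lam _ P => subterm_at P p'
  | _, _ => None
  end.

(* The variables bound by the abstractions that the path p goes through. *)
Fixpoint binders_at (S : signature) (M : term S) (p : seq step)
    : seq (var S) :=
  match p, M with
  | Fun :: p', App P _ => binders_at P p'
  | Arg :: p', App _ Q => binders_at Q p'
  | Body :: p', Lam y P => y :: binders_at P p'
  | _, _ => [::]
  end.

Definition free_occ (S : signature) (M : term S) (p : seq step) (z : var S)
    : Prop :=
  subterm_at M p = Some (Var z) /\ z \notin binders_at M p.

Definition bound_occ (S : signature) (M : term S) (p : seq step) (z : var S)
    : Prop :=
  subterm_at M p = Some (Var z) /\ z \in binders_at M p.

(* The copy of N put in place of a free occurrence p of x in M sits at p in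
   M{N/x}, so the occurrence q of N becomes the occurrence p ++ q. *)
Lemma subterm_at_subst (S : signature) (M N : term S) (x : var S)
    (p q : seq step) :
  free_occ M p x -> subterm_at (subst M x N) (p ++ q) = subterm_at N q.
Proof.
rewrite /free_occ; elim: M p => [y|f|P IHP Q IHQ|y P IH] [|[] p] //=; try by case.
- by case=> [[->]]; rewrite eqxx.
- by move=> h; apply: IHP.
- by move=> h; apply: IHQ.
- rewrite in_cons negb_or eq_sym => -[h /andP[/negbTE -> h']] /=.
  by apply: IH.
Qed.

Definition capture (S : signature) (M : term S) (x : var S) (N : term S)
    : Prop :=
  exists (p q : seq step) (z : var S),
    [/\ free_occ M p x, free_occ N q z & bound_occ (subst M x N) (p ++ q) z].

(* Main.v *)
(** In a safe judgement every free variable has at least the order of the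
    type, so the free variables of [N] have order at least [ord B = ord x].
    On the other hand, a free occurrence of [x] below a block abstraction puts
    [x] in the context of that abstraction, whose side condition makes the
    order of [x] greater than those of the variables it binds.  Hence no free
    variable of [N] is bound above a free occurrence of [x] in [M]. *)
Require Import Defs.
From HB Require Import structures.
From mathcomp Require Import all_boot finmap.

Local Open Scope fset_scope.

Lemma ord_arrs_dom (S : signature) (xs : seq (var S)) (B : sty) (y : var S) :
  y \in xs -> ord (vtype y) < ord (arrs (map vtype xs) B).
Proof.
elim: xs => //= x xs IH; rewrite in_cons leq_max => /orP[/eqP->|/IH->].
  by rewrite leqnn.
by rewrite orbT.
Qed.

(** A path that ends at a variable cannot stop inside the block, so it crosses all of [xs]. *)
Lemma subterm_at_lams_Var (S : signature) (xs : seq (var S)) (M : term S)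
    (p : seq step) (z : var S) :
  subterm_at (lams xs M) p = Some (Var z) ->
  exists2 q, subterm_at M q = Some (Var z) &
             binders_at (lams xs M) p = xs ++ binders_at M q.
Proof.
elim: xs p => [|x xs IH] p /=; first by exists p.
by case: p => [|[] p] //= /IH[q Mq ->]; exists q.
Qed.

(** No abstraction along [p] binds [x], so the substitution goes through each of them and keeps its
    binder. *)
Lemma binders_at_subst (S : signature) (M N : term S) (x : var S)
    (p q : seq step) :
  free_occ M p x ->
  binders_at (subst M x N) (p ++ q) = binders_at M p ++ binders_at N q.
Proof.
rewrite /free_occ; elim: M p => [y|f|P IHP Q IHQ|y P IH] [|[] p] //=; try by case.
- by case=> [[->]]; rewrite eqxx.
- by move=> h; apply: IHP.
- by move=> h; apply: IHQ.
- rewrite in_cons negb_or eq_sym => -[h /andP[/negbTE -> h']] /=.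
  by rewrite IH.
Qed.

Definition low_binders (S : signature) (M : term S) (p : seq step) (z : var S)
    : Prop :=
  forall y, y \in binders_at M p -> ord (vtype y) < ord (vtype z).

Scheme safe_mind := Minimality for safe Sort Prop
  with asa_mind := Minimality for asa Sort Prop.

Lemma safe_free_occ (S : signature) (G : ctx S) (M : term S) (A : sty)
    (p : seq step) (z : var S) :
  safe G M A -> free_occ M p z ->
  [/\ z \in G, ord A <= ord (vtype z) & low_binders S M p z].
Proof.
move=> hM; move: G M A hM p z; apply: (safe_mind S
  (fun G M A => forall p z, free_occ M p z ->
     [/\ z \in G, ord A <= ord (vtype z) & low_binders S M p z])
  (* The order bound can fail for [asa], as [asa_app] has no side condition; [safe_app] and
     [safe_abs] recover it from [z \in G]. *)
  (fun G M A => forall p z, free_occ M p z ->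
     z \in G /\ low_binders S M p z)).
- by move=> x [|[] p] z [] //= [<-] _; rewrite inE eqxx; split.
- by move=> f [|[] p] z [].
- move=> G D M A _ IH /fsubsetP GD p z /IH[zG Az low].
  by split=> //; apply: GD.
- move=> G M N A B _ IHM _ IHN leG [|[] p] z [] //= Mp zp.
    by have [zG low] := IHM p z (conj Mp zp); split=> //; apply: leG.
  by have [zG _ low] := IHN p z (conj Mp zp); split=> //; apply: leG.
- move=> G xs M B _ _ _ IH leG p z [/subterm_at_lams_Var[q Mq bE]].
  rewrite bE mem_cat negb_or => /andP[zxs zq].
  have [] := IH q z (conj Mq zq).
  rewrite !inE (negbTE zxs) orbF => zG low.
  have lez := leG z zG; split=> // y; rewrite bE mem_cat => /orP[yxs|/low//].
  exact: leq_trans (ord_arrs_dom _ _ _ _ yxs) lez.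
- by move=> G M A _ IH p z /IH[].
- move=> G M N A B _ IHM _ IHN [|[] p] z [] //= Mp zp.
    exact: IHM p z (conj Mp zp).
  by have [zG _ low] := IHN p z (conj Mp zp).
Qed.

Theorem lemma1p10 (S : signature) (G : ctx S) (x : var S) (M N : term S)
    (A B : sty) (hx : vtype x = B)
    (hM : safe (G `|` [fset x]) M A) (hN : safe G N B) :
  ~ capture M x N.
Proof.
case=> p [q [z [xp zq [_]]]].
(* Since [z] is free at [q] in [N], its binder must lie on the path [p] in [M]. *)
rewrite binders_at_subst // mem_cat (negbTE zq.2) orbF.
have [_ _ low] := safe_free_occ _ _ _ _ _ _ hM xp.
have [_ leBz _] := safe_free_occ _ _ _ _ _ _ hN zq.
by move=> /low; rewrite hx ltnNge leBz.
Qed.
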